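(* Let $N\ge 1$, let $D\subseteq\{0,1\}^N$ be a finite nonempty set, and let $f:D\to\{0,1\}$ be any function. Then $$Q_2(f)\;\le\;\max_{\mu}Q_{WE}^{\mu}(f),$$ where the maximum ranges over all probability distributions $\mu$ on $D$.
   Context: Quantum query model. The input $x\in D\subseteq\{0,1\}^N$ is accessed through the unitary $O=O_x$ acting on basis states by $O|i,b,z\rangle=|i,b\oplus x_i,z\rangle$, with $i\in\{1,\dots,N\}$, $b\in\{0,1\}$ and $z$ a workspace of finitely many qubits. A $T$-query quantum algorithm is $A=U_TOU_{T-1}O\cdots U_1OU_0$, with each $U_j$ a fixed unitary independent of $x$; it starts in the all-zero state $|0\dots0\rangle$, and its output is obtained by measuring the rightmost bit of the final state $A|0\dots 0\rangle$. Its complexity is $T$. $P_A(x)$ denotes the probability that $A$ outputs $1$ on input $x$, and $S_A(x)$ (success probability) the probability that $A$ outputs $f(x)$ on input $x\in D$. $Q_2(f)$ is the minimal number of queries of a quantum algorithm $A$ with $S_A(x)\ge \frac23$ for all $x\in D$. For a probability distribution $\mu$ on $D$, an algorithm $A$ is weakly $\frac23$-exact for $f$ with respect to $\mu$ if $\mu(\{x\in D: P_A(x)=f(x)\})\ge\frac23$. $Q_{WE}^\mu(f)$ is the minimal number of queries of a weakly $\frac23$-exact algorithm for $f$ with respect to $\mu$. *)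

(* Defs.v *)
From mathcomp Require Import all_boot all_order all_algebra spectral complex.
From mathcomp Require Import boolp reals.

Set Implicit Arguments.
Unset Strict Implicit.
Unset Printing Implicit Defensive.

Import Order.TTheory GRing.Theory Num.Theory.
Local Open Scope ring_scope.

(* Basis states |i, b, z> with m workspace qubits z.  The indices 1, ..., N are
   represented by 'I_N, so the all-zero state has i = 0, the first index. *)
Definition basis (N m : nat) : finType := ('I_N * bool * m.-tuple bool)%type.

Definition dim (N m : nat) : nat := #|basis N m|.

Definition is_zero (N m : nat) (s : basis N m) : bool :=
  [&& val s.1.1 == 0%N, ~~ s.1.2 & s.2 == [tuple of nseq m false]].

(* If there is no workspace, the rightmost bit of |i, b> is b. *)
Definition rightmost (N m : nat) (s : basis N m) : bool := last s.1.2 s.2.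

Section Model.
Variable R : realType.

Definition map_basis_mx (N m : nat) (g : basis N m -> basis N m) :
    'M[R[i]]_(dim N m) :=
  \matrix_(s, t) (enum_val s == g (enum_val t))%:R.

Definition oracle_map (N m : nat) (x : N.-tuple bool) (s : basis N m) :
    basis N m :=
  (s.1.1, s.1.2 (+) tnth x s.1.1, s.2).

Definition oracle (N m : nat) (x : N.-tuple bool) : 'M[R[i]]_(dim N m) :=
  map_basis_mx (oracle_map x).

Definition ket0 (N m : nat) : 'cV[R[i]]_(dim N m) :=
  \col_s (is_zero (enum_val s))%:R.

(* The algorithm U_T O U_(T-1) O ... U_1 O U_0 is given by U_0 and by the list
   U_1, ..., U_T, whose length T is its number of queries. *)
Record qalg (N : nat) := QAlg {
  workspace : nat;
  unitary0 : 'M[R[i]]_(dim N workspace);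
  unitaries : seq 'M[R[i]]_(dim N workspace);
  unitary0P : unitary0 \is unitarymx;
  unitariesP : all (fun U => U \is unitarymx) unitaries }.

Definition queries (N : nat) (A : qalg N) : nat := size (unitaries A).

Definition final_state (N : nat) (A : qalg N) (x : N.-tuple bool) :
    'cV[R[i]]_(dim N (workspace A)) :=
  foldl (fun v U => U *m (oracle _ x *m v)) (unitary0 A *m ket0 _ _)
        (unitaries A).

Definition sqmod (c : R[i]) : R := complex.Re c ^+ 2 + complex.Im c ^+ 2.

Definition out_prob (N : nat) (A : qalg N) (x : N.-tuple bool) (b : bool) : R :=
  \sum_(s | rightmost (enum_val s) == b) sqmod (final_state A x s 0).

Definition prob_one (N : nat) (A : qalg N) (x : N.-tuple bool) : R :=
  out_prob A x true.

Section Complexity.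
Variables (N : nat) (D : {set N.-tuple bool}).
Implicit Types (f : {x | x \in D} -> bool) (A : qalg N).

Definition success_prob f A (x : {x | x \in D}) : R := out_prob A (val x) (f x).

Record distr := Distr {
  mass :> {x | x \in D} -> R;
  mass_ge0 : forall x, 0 <= mass x;
  mass_sum1 : \sum_x mass x = 1 }.

Definition two_sided f A : Prop := forall x, 2 / 3 <= success_prob f A x.

Definition weakly_exact (mu : distr) f A : Prop :=
  2 / 3 <= \sum_(x | prob_one A (val x) == (f x)%:R) mu x.

Definition has_alg (good : qalg N -> Prop) (T : nat) : bool :=
  `[< exists A, queries A = T /\ good A >].

End Complexity.
End Model.

(* Every f is computed exactly, with error probability 0, by N + 1 queries: N of
   them copy x into the workspace, the last one is ignored.  Hence the minima and
   the maximum defined below exist. *)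
Section Exact.
Variables (R : realType) (N : nat) (hN : (0 < N)%N).
Variables (D : {set N.-tuple bool}) (f : {x | x \in D} -> bool).

Definition ket m (s : basis N m) : 'cV[R[i]]_(dim N m) :=
  \col_t (enum_val t == s)%:R.

Lemma map_basis_mx_ket m (g : basis N m -> basis N m) s :
  map_basis_mx R g *m ket s = ket (g s).
Proof.
apply/colP => t; rewrite !mxE (bigD1 (enum_rank s)) //= !mxE enum_rankK eqxx.
rewrite mulr1 big1 ?addr0 // => k /negbTE nk; rewrite !mxE.
by rewrite (can2_eq enum_valK enum_rankK k s) nk mulr0.
Qed.

Lemma map_basis_mx_unitary m (g : basis N m -> basis N m) :
  injective g -> map_basis_mx R g \is unitarymx.
Proof.
move=> g_inj; rewrite -trmx_unitary; apply/unitarymxP/matrixP => s t.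
rewrite !mxE (bigD1 (enum_rank (g (enum_val s)))) //= !mxE enum_rankK eqxx.
rewrite mul1r big1 ?addr0 => [|k nk].
  by rewrite rmorph_nat (inj_eq g_inj) (inj_eq enum_val_inj).
by rewrite !mxE (can2_eq enum_valK enum_rankK k) (negbTE nk) mul0r.
Qed.

(* Store the queried bit in cell i of the workspace and move on to i + 1. *)
Definition store_map (s : basis N N.+1) : basis N N.+1 :=
  (ordS s.1.1, tnth s.2 (widen_ord (leqnSn N) s.1.1),
   [tuple (if val j == val s.1.1 then s.1.2 else tnth s.2 j) | j < N.+1]).

Lemma store_map_inj : injective store_map.
Proof.
move=> [[i b] z] [[i' b'] z'] e.
have ei : i = i' by apply: (can_inj (@ordSK N)); have := congr1 (fun s => s.1.1) e.
have e2 := congr1 (fun s => s.1.2) e; have e3 := congr1 snd e.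
rewrite /= in e2 e3; subst i'; have ej j : (if val j == val i then b else tnth z j) =
    (if val j == val i then b' else tnth z' j).
  by have := congr1 (fun u => tnth u j) e3; rewrite !tnth_mktuple.
have := ej (widen_ord (leqnSn N) i); rewrite /= eqxx => ->.
congr (_, _, _); apply: eq_from_tnth => j; have := ej j.
have [eji _|//] := eqVneq (val j) (val i).
by have -> : j = widen_ord (leqnSn N) i by apply: val_inj.
Qed.

Definition read (z : N.+1.-tuple bool) : N.-tuple bool :=
  [tuple tnth z (widen_ord (leqnSn N) j) | j < N].

(* f, extended by false outside of D. *)
Definition eval_f (x : N.-tuple bool) : bool :=
  if insub x is Some y then f y else false.

Definition answer_map (s : basis N N.+1) : basis N N.+1 :=
  (s.1, [tuple (if j == ord_max then tnth s.2 j (+) eval_f (read s.2)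
                else tnth s.2 j) | j < N.+1]).

Lemma read_answer s : read (answer_map s).2 = read s.2.
Proof.
apply: eq_from_tnth => j; rewrite !tnth_mktuple ifN //.
by rewrite -val_eqE /= neq_ltn ltn_ord.
Qed.

Lemma answer_mapK : involutive answer_map.
Proof.
move=> s; rewrite [LHS]surjective_pairing [RHS]surjective_pairing.
congr (_, _); apply: eq_from_tnth => j.
rewrite [answer_map _]/answer_map read_answer !tnth_mktuple.
by case: eqP => // _; rewrite -addbA addbb addbF.
Qed.

Definition exact_alg : qalg R N.
Proof.
refine (@QAlg R N N.+1 1%:M
  (rcons (nseq N (map_basis_mx R store_map)) (map_basis_mx R answer_map)) _ _).
  by apply/unitarymxP; rewrite trmx1 map_mx1 mulmx1.
rewrite all_rcons map_basis_mx_unitary /=; last exact: inv_inj answer_mapK.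
by rewrite all_nseq map_basis_mx_unitary ?orbT //; exact: store_map_inj.
Defined.

Lemma queries_exact : queries exact_alg = N.+1.
Proof. by rewrite /queries size_rcons size_nseq. Qed.

Definition partial_state (x : N.-tuple bool) k : basis N N.+1 :=
  (Ordinal (ltn_pmod k hN), false,
   [tuple (j < k)%N && nth false x j | j < N.+1]).

Lemma store_step x k : (k < N)%N ->
  store_map (oracle_map x (partial_state x k)) = partial_state x k.+1.
Proof.
move=> kN; rewrite /store_map /oracle_map /partial_state /=.
set i := Ordinal _; have ik : nat_of_ord i = k by rewrite /= modn_small.
congr (_, _, _).
- by apply: val_inj; rewrite /= (modn_small kN).
- by rewrite tnth_mktuple /= modn_small // ltnn.
apply: eq_from_tnth => j; rewrite !tnth_mktuple ltnS.
have -> : (k %% N)%N = k by rewrite modn_small.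
have [->|nj] := eqVneq (val j) k; first by rewrite leqnn (tnth_nth false) ik.
by rewrite [(j <= k)%N]leq_eqVlt (negbTE nj).
Qed.

Lemma ket0E x : ket0 R N N.+1 = ket (partial_state x 0).
Proof.
apply/colP => t; rewrite !mxE; congr (_%:R); congr nat_of_bool.
case: (enum_val t) => [[i b] z]; rewrite /is_zero /partial_state !xpair_eqE.
rewrite -andbA -[i == _]val_eqE [val (Ordinal _)]mod0n eqbF_neg.
suff -> : [tuple false && nth false x j | j < N.+1] = [tuple of nseq N.+1 false].
  by [].
by apply: eq_from_tnth => j; rewrite tnth_mktuple tnth_nseq.
Qed.

Lemma exact_final x : exists s : basis N N.+1,
  rightmost s = eval_f x /\ final_state exact_alg x = ket s.
Proof.
exists (answer_map (oracle_map x (partial_state x N))); split; last first.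
  rewrite /final_state /= foldl_rcons mul1mx (ket0E x).
  suff -> k : (k <= N)%N -> foldl (fun v U => U *m (oracle R N.+1 x *m v))
      (ket (partial_state x 0)) (nseq k (map_basis_mx R store_map))
      = ket (partial_state x k).
  - by rewrite !map_basis_mx_ket.
  - by [].
  elim: k => // k IHk kN; rewrite -[nseq k.+1 _]/(nseq 1 _ ++ nseq k _) -nseqD addnC nseqD foldl_cat IHk ?(ltnW kN) //=.
  by rewrite !map_basis_mx_ket store_step.
set t := answer_map _.
have -> : rightmost t = tnth t.2 ord_max.
  by rewrite /rightmost (last_nth false) size_tuple (tnth_nth false).
rewrite tnth_mktuple eqxx tnth_mktuple ltnn /=; congr eval_f.
by apply: eq_from_tnth => j; rewrite !tnth_mktuple /= ltn_ord -tnth_nth.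
Qed.

Lemma exact_out (x : {x | x \in D}) b :
  out_prob exact_alg (val x) b = (b == f x)%:R.
Proof.
have [s [rs fs]] := exact_final (val x).
have {}rs : rightmost s = f x by rewrite rs /eval_f valK.
rewrite /out_prob (eq_bigr (fun t => (enum_val t == s)%:R)) => [|t _]; last first.
  by rewrite fs mxE /sqmod; case: (_ == s); rewrite /= ?expr1n ?expr0n /= addr0.
rewrite big_mkcond (bigD1 (enum_rank s)) //= enum_rankK eqxx rs eq_sym.
rewrite big1 ?addr0 => [|t nt]; first by case: ifP.
by rewrite (can2_eq enum_valK enum_rankK t) (negbTE nt) if_same.
Qed.

Lemma two_thirds_le1 : 2 / 3 <= 1 :> R.
Proof. by rewrite ler_pdivrMr ?ltr0n // mul1r ler_nat. Qed.

Lemma has_two_sided : has_alg (two_sided f) N.+1 (R := R).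
Proof.
apply/asboolP; exists exact_alg; split; first exact: queries_exact.
by move=> x; rewrite /success_prob exact_out eqxx two_thirds_le1.
Qed.

Lemma has_weakly_exact (mu : distr R D) : has_alg (weakly_exact mu f) N.+1.
Proof.
apply/asboolP; exists exact_alg; split; first exact: queries_exact.
rewrite /weakly_exact (eq_bigl xpredT) ?mass_sum1 ?two_thirds_le1 // => x.
by rewrite /prob_one exact_out; case: (f x); rewrite /= eqxx.
Qed.

Lemma ex_two_sided : exists T, has_alg (R := R) (two_sided f) T.
Proof. by exists N.+1; exact: has_two_sided. Qed.

Lemma ex_weakly_exact (mu : distr R D) :
  exists T, has_alg (weakly_exact mu f) T.
Proof. by exists N.+1; exact: has_weakly_exact. Qed.

Definition Q2 : nat := ex_minn ex_two_sided.

Definition QWE (mu : distr R D) : nat := ex_minn (ex_weakly_exact mu).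

Hypothesis hD : D != set0.

Definition QWE_value (T : nat) : bool := `[< exists mu, QWE mu = T >].

Lemma ex_QWE_value : exists T, QWE_value T.
Proof.
have [x xD] := set0Pn _ hD.
have mu_ge0 (y : {x | x \in D}) : 0 <= (val y == x)%:R :> R by exact: ler0n.
have mu_sum : \sum_(y : {x | x \in D}) (val y == x)%:R = 1 :> R.
  rewrite (bigD1 (exist _ x xD)) //= eqxx big1 ?addr0 // => y.
  by rewrite -val_eqE /= => /negbTE ->.
by exists (QWE (Distr mu_ge0 mu_sum)); apply/asboolP; eexists.
Qed.

Lemma QWE_value_le T : QWE_value T -> (T <= N.+1)%N.
Proof.
move=> /asboolP[mu <-]; rewrite /QWE; case: ex_minnP => k _; apply.
exact: has_weakly_exact.
Qed.

Definition max_QWE : nat := ex_maxn ex_QWE_value QWE_value_le.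

End Exact.

(* Main.v *)
(* Let T be the maximum of the weakly exact complexities.  Against every mu some
   T-query algorithm is exact on a set of inputs of mu-measure at least 2/3, so
   by the minimax theorem, applied to the finite 0/1 matrix whose rows are the
   sets on which some T-query algorithm is exact, there is a distribution over
   T-query algorithms such that each input is answered exactly with probability
   at least 2/3.  Running these algorithms in a superposition weighted by the
   square roots of the probabilities, in orthogonal sectors of a larger
   workspace, turns the distribution into one quantum algorithm.  Its unitaries
   need not be written down: a unitary mapping given vectors to given vectors
   exists as soon as the two Gram matrices agree. *)
From mathcomp Require Import boolp classical_sets reals topology normedtype derive.
From mathcomp Require Import all_boot all_order all_algebra.
From mathcomp Require Import sesquilinear spectral complex.
From mathcomp Require Import ring lra.
Require Import Defs.

Set Implicit Arguments.
Unset Strict Implicit.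
Unset Printing Implicit Defensive.

Import Order.TTheory GRing.Theory Num.Theory.
Import numFieldNormedType.Exports.
Local Open Scope ring_scope.

(** * Finite minimax theorem *)

Lemma continuous_sum (R : realType) (T : topologicalType) (I : finType)
    (F : I -> T -> R) :
  (forall i, continuous (F i)) -> continuous (fun t => \sum_i F i t).
Proof.
move=> cF; apply: (@continuous_big _ _ _ _ xpredT) => [|i _]; last exact: cF.
exact: add_continuous.
Qed.

(** The simplex is a closed subset of a cube; its compactness provides the minimiser in
    [minimax]. *)
Lemma compact_simplex (R : realType) n :
  compact [set p : 'rV[R]_n | (forall j, 0 <= p 0 j) /\ \sum_j p 0 j = 1]%classic.
Proof.
set S := mkset _.
have -> : S = ([set p : 'rV[R]_n | forall j, (`[0, 1]%classic (p ord0 j))] `&`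
   (fun p : 'rV[R]_n => \sum_j p 0 j) @^-1` [set x | x = 1])%classic.
  apply/seteqP; split => p /= [p0 p1]; split => // j.
    rewrite in_itv /= p0 -p1 (bigD1 j) //= lerDl sumr_ge0 // => k _; exact: p0.
  by have := p0 j; rewrite in_itv /= => /andP[].
apply: compact_closedI.
  by apply: (@rV_compact R n (fun=> `[0, 1]%classic)) => j; exact: segment_compact.
apply: preimage_closed; last exact: closed_eq.
move=> p _; apply: (@continuous_sum _ _ _ (fun j (q : 'rV[R]_n) => q 0 j)) => j.
exact: coord_continuous.
Qed.

(* Minimise the squared distance from the mixed payoff vector to the orthant
   [c, +oo)^X; if the minimum were positive, the normalised displacement would
   be a distribution against which every row pays less than c. *)
Lemma minimax (R : realType) n (X : finType) (x0 : X) (M : 'I_n -> X -> R) (c : R) :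
    (forall mu : X -> R, (forall x, 0 <= mu x) -> \sum_x mu x = 1 ->
       exists j, c <= \sum_x mu x * M j x) ->
  exists p : 'I_n -> R, [/\ forall j, 0 <= p j, \sum_j p j = 1 &
    forall x, c <= \sum_j p j * M j x].
Proof.
move=> hM.
pose v (p : 'rV[R]_n) x := \sum_j p 0 j * M j x - c.
pose neg (a : R) := Num.max (- a) 0.
pose phi p := \sum_x neg (v p x) ^+ 2.
set S := [set p : 'rV[R]_n | (forall j, 0 <= p 0 j) /\ \sum_j p 0 j = 1]%classic.
(* The hypothesis at the point mass on [x0] yields a row, hence a vertex of the simplex. *)
have S0 : (S !=set0)%classic.
  have [||j _] := hM (fun x => (x == x0)%:R).
  - by move=> x; exact: ler0n.
  - by rewrite (bigD1 x0) //= eqxx big1 ?addr0 // => x /negbTE ->.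
  exists (delta_mx 0 j); split => [k|]; first by rewrite mxE ler0n.
  rewrite (bigD1 j) //= mxE !eqxx big1 ?addr0 // => k /negbTE nk.
  by rewrite mxE nk andbF.
have cphi : continuous phi.
  have cv x : continuous (v ^~ x).
    move=> p; apply: continuousB; last exact: cst_continuous.
    apply: (@continuous_sum _ _ _ (fun j (q : 'rV[R]_n) => q 0 j * M j x)) => j q.
    by apply: continuousM; [exact: coord_continuous|exact: cst_continuous].
  have cn x : continuous (fun p => neg (v p x)).
    move=> p; rewrite /neg.
    apply: (@continuous_max _ _ (fun p => - v p x) (fun=> 0) p).
      by apply: continuousN; exact: cv.
    exact: cst_continuous.
  apply: (@continuous_sum _ _ _ (fun x q => neg (v q x) ^+ 2)) => x p.
  pose g p := neg (v p x).
  by apply: (@continuousM _ _ g g p); exact: cn.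
have [|p /set_mem[p0 p1] pmin] := EVT_min_rV S0 (@compact_simplex R n) (f := phi).
  exact: continuous_subspaceT.
pose nu x := neg (v p x).
have nu0 x : 0 <= nu x by rewrite /nu /neg le_max lexx orbT.
have nuv x : nu x * v p x = - nu x ^+ 2.
  by rewrite /nu /neg; case: (lerP (- v p x) 0) => h; lra.
(* First-order optimality of [p] on the segment towards the vertex [j]: the derivative of [phi]
   there is -2 times the sum of [nu x * d x]. *)
have first_order j : \sum_x nu x * (M j x - c) <= \sum_x nu x * v p x.
  pose d x := M j x - c - v p x.
  suff: \sum_x nu x * d x <= 0.
    under eq_bigr do rewrite mulrBr.
    by rewrite sumrB subr_le0.
  have step t : 0 <= t <= 1 ->
      0 <= t * (t * \sum_x d x ^+ 2 - 2 * \sum_x nu x * d x).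
    move=> /andP[t0 t1].
    pose q := (1 - t) *: p + t *: delta_mx 0 j.
    have qE k : q 0 k = (1 - t) * p 0 k + t * (k == j)%:R by rewrite !mxE eqxx.
    have vq x : v q x = v p x + t * d x.
      have -> : v q x = (1 - t) * \sum_k p 0 k * M k x + t * M j x - c.
        congr (_ - c); under eq_bigr do rewrite qE mulrDl -!mulrA.
        rewrite big_split /= -!mulr_sumr; congr (_ + t * _).
        rewrite (bigD1 j) //= eqxx mul1r big1 ?addr0 // => k /negbTE ->.
        by rewrite mul0r.
      by rewrite /d /v; ring.
    have Sq : S q.
      split => [k|].
        by rewrite qE addr_ge0 ?mulr_ge0 ?ler0n ?subr_ge0 //; exact: p0.
      under eq_bigr do rewrite qE.
      rewrite big_split /= -!mulr_sumr p1 (bigD1 j) //= eqxx big1 => [|k /negbTE -> //].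
      by rewrite addr0 mulr1 mulr1 subrK.
    have := pmin q (mem_set Sq); rewrite -subr_ge0 => /le_trans; apply.
    rewrite mulrBr mulrA -subr_ge0 !mulr_sumr.
    rewrite /phi -!sumrB sumr_ge0 // => x _; rewrite vq /nu /neg.
    (* neg (v + t d) ^ 2 <= (neg v - t d) ^ 2 *)
    by case: (lerP (- (v p x)) 0) => h1;
      case: (lerP (- (v p x + t * d x)) 0) => h2; nra.
  rewrite leNgt; apply/negP => pos.
  set a := \sum_x nu x * d x in pos step.
  set b := \sum_x _ in step.
  have b0 : 0 <= b by apply: sumr_ge0 => x _; exact: sqr_ge0.
  (* Chosen so that [t <= 1] and [t * b <= a < 2 * a], which contradicts [step]. *)
  pose t := a / (a + b + 1).
  have ab : 0 < a + b + 1 by lra.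
  have t0 : 0 < t by rewrite divr_gt0.
  have t1 : t <= 1 by rewrite ler_pdivrMr // ; lra.
  have := step t; rewrite (ltW t0) t1 => /(_ isT); rewrite pmulr_rge0 //.
  have : t * b <= a.
    by rewrite mulrAC ler_pdivrMr // ler_pM2l //; lra.
  lra.
have sq0 : \sum_x nu x ^+ 2 = 0.
  apply/eqP; rewrite eq_le [X in _ && X]sumr_ge0 ?andbT => [|x _]; last exact: sqr_ge0.
  rewrite leNgt; apply/negP => pos.
  have s0 : 0 < \sum_x nu x.
    rewrite lt_def sumr_ge0 ?andbT // psumr_eq0 //; apply/negP => /allP nu_0.
    move: pos; rewrite big1 ?ltxx // => x _.
    by rewrite (eqP (implyP (nu_0 x (mem_index_enum x)) isT)) expr0n.
  set s := \sum_x nu x in s0.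
  have [||j] := hM (fun x => nu x / s).
  - by move=> x; rewrite divr_ge0 // ltW.
  - by rewrite -mulr_suml divff // gt_eqF.
  rewrite leNgt => /negP; apply.
  under eq_bigr do rewrite mulrAC.
  rewrite -mulr_suml ltr_pdivrMr // -subr_lt0 mulr_sumr -sumrB.
  under eq_bigr do rewrite [c * _]mulrC -mulrBr.
  (* By [nuv] this bound is minus the sum of the [nu x ^+ 2], negative by [pos]. *)
  apply: (le_lt_trans (first_order j)).
  by under eq_bigr do rewrite nuv; rewrite sumrN oppr_lt0.
exists (p 0); split => // x.
have : nu x ^+ 2 = 0.
  apply/eqP; move/eqP: sq0; rewrite psumr_eq0 => [/allP h|y _]; last exact: sqr_ge0.
  exact: (implyP (h x (mem_index_enum x)) isT).
move/eqP; rewrite sqrf_eq0 => /eqP; rewrite /nu /neg /v.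
case: (lerP (- (\sum_j p 0 j * M j x - c)) 0); lra.
Qed.

(** * Unitaries from Gram matrices *)

Local Open Scope sesquilinear_scope.

Section Gram.
Variable C : numClosedFieldType.

Definition dot n (u v : 'cV[C]_n) : C := (u ^t* *m v) 0 0.

Lemma adjD m n (A B : 'M[C]_(m, n)) : (A + B)^t* = A^t* + B^t*.
Proof. by rewrite linearD map_mxD. Qed.

Lemma adjZ m n a (A : 'M[C]_(m, n)) : (a *: A)^t* = a^* *: A^t*.
Proof. by rewrite linearZ map_mxZ. Qed.

Lemma adjM m n p (A : 'M[C]_(m, n)) (B : 'M[C]_(n, p)) :
  (A *m B)^t* = B^t* *m A^t*.
Proof. by rewrite trmx_mul map_mxM. Qed.

Lemma dotE n (u v : 'cV[C]_n) : dot u v = \sum_i (u i 0)^* * v i 0.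
Proof. by rewrite /dot mxE; apply: eq_bigr => i _; rewrite !mxE. Qed.

Lemma dotC n (u v : 'cV[C]_n) : (dot u v)^* = dot v u.
Proof.
rewrite !dotE rmorph_sum; apply: eq_bigr => i _.
by rewrite rmorphM /= conjCK mulrC.
Qed.

Lemma dotBl n (u v w : 'cV[C]_n) : dot (u - v) w = dot u w - dot v w.
Proof. by rewrite !dotE -sumrB; apply: eq_bigr => i _; rewrite !mxE rmorphB mulrBl. Qed.

Lemma dotBr n (u v w : 'cV[C]_n) : dot u (v - w) = dot u v - dot u w.
Proof. by rewrite !dotE -sumrB; apply: eq_bigr => i _; rewrite !mxE mulrBr. Qed.

Lemma dotZ n a b (u v : 'cV[C]_n) : dot (a *: u) (b *: v) = a^* * b * dot u v.
Proof.
rewrite !dotE mulr_sumr; apply: eq_bigr => i _.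
by rewrite !mxE rmorphM mulrACA.
Qed.

Lemma dot_suml n (I : Type) (r : seq I) (F : I -> 'cV[C]_n) v :
  dot (\sum_(i <- r) F i) v = \sum_(i <- r) dot (F i) v.
Proof.
rewrite dotE; under [RHS]eq_bigr do rewrite dotE.
rewrite exchange_big; apply: eq_bigr => i _.
by rewrite summxE rmorph_sum mulr_suml.
Qed.

Lemma dot_sumr n (I : Type) (r : seq I) (F : I -> 'cV[C]_n) v :
  dot v (\sum_(i <- r) F i) = \sum_(i <- r) dot v (F i).
Proof.
rewrite dotE; under [RHS]eq_bigr do rewrite dotE.
rewrite exchange_big; apply: eq_bigr => i _.
by rewrite summxE mulr_sumr.
Qed.

Lemma dot_eq0 n (u : 'cV[C]_n) : (dot u u == 0) = (u == 0).
Proof.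
rewrite dotE; apply/eqP/eqP => [/eqP|->]; last first.
  by rewrite big1 // => i _; rewrite !mxE mulr0.
rewrite psumr_eq0 => [/allP h|i _]; last by rewrite mulrC mul_conjC_ge0.
apply/colP => i; rewrite mxE; apply/eqP; rewrite -mul_conjC_eq0 mulrC.
exact: (implyP (h i (mem_index_enum i)) isT).
Qed.

Lemma unitarymx_adjK n (V : 'M[C]_n) : V \is unitarymx -> V^t* *m V = 1%:M.
Proof. by rewrite -trmxC_unitary => /unitarymxP; rewrite trmxCK. Qed.

Lemma dot_unitary n (V : 'M[C]_n) u v :
  V \is unitarymx -> dot (V *m u) (V *m v) = dot u v.
Proof. by move=> VU; rewrite /dot adjM mulmxA -(mulmxA _ _ V) unitarymx_adjK // mulmx1. Qed.

Lemma unitarymx1 n : 1%:M \is @unitarymx C n n.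
Proof. by apply/unitarymxP; rewrite trmx1 map_mx1 mulmx1. Qed.

(* The Householder reflection [1 - u u^* / <u, x>] with [u = x - y]; it is the
   identity on the orthogonal complement of [u]. *)
Lemma reflection n (x y : 'cV[C]_n) : dot x x = dot y y ->
  exists V : 'M[C]_n, [/\ V \is unitarymx, V *m x = y &
    forall z, dot x z = dot y z -> V *m z = z].
Proof.
move=> exy; have [u uE] : exists u, u = x - y by exists (x - y).
have [u0|nu] := eqVneq u 0.
  exists 1%:M; split=> [||z _]; rewrite ?unitarymx1 ?mul1mx //.
  by apply/eqP; rewrite -subr_eq0 -uE u0.
pose e := dot u x.
(* Equality of the norms enters here. The identity gives [e != 0] and, divided by [e * e^*], the
   cancellation behind the unitarity of [V]. *)
have ee : e + e^* = dot u u.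
  by rewrite /e dotC uE !dotBl !dotBr exy; ring.
have ne : e != 0.
  apply: contra nu => /eqP e0.
  by rewrite -dot_eq0 -ee e0 rmorph0 addr0.
pose V := 1%:M - e^-1 *: (u *m u^t*).
have Vz z : V *m z = z - (e^-1 * dot u z) *: u.
  rewrite mulmxBl mul1mx -scalemxAl -mulmxA [u^t* *m z]mx11_scalar.
  by rewrite mul_mx_scalar scalerA.
exists V; split => [||z xyz]; last 2 first.
- by rewrite Vz mulVf // scale1r uE opprB addrC subrK.
- by rewrite Vz uE dotBl xyz subrr mulr0 scale0r subr0.
have VtE : V^t* = 1%:M - e^*^-1 *: (u *m u^t*).
  by rewrite /V -scaleNr adjD adjZ adjM trmxCK trmx1 map_mx1 rmorphN fmorphV scaleNr.
apply/unitarymxP; rewrite VtE mulmxBr mulmx1 -scalemxAr mulmxA Vz.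
rewrite -/(dot u u) -ee.
have nec : e^* != 0 by rewrite conjC_eq0.
rewrite /V mulmxBl -scalemxAl scalerBr scalerA -addrA -opprD.
rewrite -scalerBl -scalerDl.
have -> : e^-1 + (e^*^-1 - e^*^-1 * (e^-1 * (e + e^*))) = 0 by field; rewrite ne.
by rewrite scale0r subr0.
Qed.

(** Induction over the vectors: a reflection sends [V *m x i] to [y i]. It fixes each earlier
    [y j = V *m x j], because the equal Gram matrices give [V *m x i] and [y i] the same inner
    product with it. *)
Lemma gram_unitary (I : finType) n (x y : I -> 'cV[C]_n) :
    (forall i j, dot (x i) (x j) = dot (y i) (y j)) ->
  exists2 V : 'M[C]_n, V \is unitarymx & forall i, V *m x i = y i.
Proof.
move=> gxy.
suff [V [VU Vx]] : exists V : 'M[C]_n, V \is unitarymx /\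
    forall i, i \in enum I -> V *m x i = y i.
  by exists V => // i; apply: Vx; rewrite mem_enum.
elim: (enum I) => [|i s [V [VU Vx]]].
  by exists 1%:M; split; rewrite ?unitarymx1.
have [|W [WU Wx Wid]] := @reflection n (V *m x i) (y i).
  by rewrite dot_unitary.
exists (W *m V); split => [|j]; first exact: mul_unitarymx.
rewrite inE -mulmxA => /predU1P[-> //|js].
by rewrite (Vx _ js) Wid // -{1}(Vx _ js) dot_unitary.
Qed.

End Gram.

(** * Runs of query algorithms *)

Local Open Scope complex_scope.

Section Runs.
Variable R : realType.

(* [map_basis_mx] between two different bases; [oracle R m x] is convertible to
   [fun_mx (oracle_map x)]. *)
Definition fun_mx (S T : finType) (g : S -> T) : 'M[R[i]]_(#|T|, #|S|) :=
  \matrix_(s, t) (enum_val s == g (enum_val t))%:R.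

Lemma fun_mx_comp (S T U : finType) (g : T -> U) (h : S -> T) :
  fun_mx g *m fun_mx h = fun_mx (g \o h).
Proof.
apply/matrixP => s t; rewrite !mxE (bigD1 (enum_rank (h (enum_val t)))) //=.
rewrite !mxE enum_rankK eqxx mulr1 big1 ?addr0 // => k /negbTE nk.
by rewrite !mxE (can2_eq enum_valK enum_rankK k (h _)) nk mulr0.
Qed.

(** One formula for two uses: it is the identity for a single injective map, and zero for maps with
    disjoint images. *)
Lemma fun_mx_adj (S S' T : finType) (g : S -> T) (h : S' -> T) :
  (fun_mx g)^t* *m fun_mx h =
  \matrix_(s, t) (g (enum_val s) == h (enum_val t))%:R.
Proof.
apply/matrixP => s t; rewrite !mxE (bigD1 (enum_rank (h (enum_val t)))) //=.
rewrite !mxE enum_rankK eqxx mulr1 big1 ?addr0 => [|k /negbTE nk].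
  by rewrite rmorph_nat eq_sym.
by rewrite !mxE (can2_eq enum_valK enum_rankK k (h _)) nk mulr0.
Qed.

Lemma dot_fun_mx (S T : finType) (g : S -> T) u v :
  injective g -> dot (fun_mx g *m u) (fun_mx g *m v) = dot u v.
Proof.
move=> g_inj; rewrite /dot adjM mulmxA -(mulmxA _ _ (fun_mx g)) fun_mx_adj.
rewrite [X in _ *m X *m _](_ : _ = 1%:M) ?mulmx1 //.
by apply/matrixP => s t; rewrite !mxE (inj_eq g_inj) (inj_eq enum_val_inj).
Qed.

Lemma dot_fun_mx0 (S S' T : finType) (g : S -> T) (h : S' -> T) u v :
  (forall s t, g s != h t) -> dot (fun_mx g *m u) (fun_mx h *m v) = 0.
Proof.
move=> gh; rewrite /dot adjM mulmxA -(mulmxA _ _ (fun_mx h)) fun_mx_adj.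
rewrite [X in _ *m X *m _](_ : _ = 0) ?mulmx0 ?mul0mx ?mxE //.
by apply/matrixP => s t; rewrite !mxE (negbTE (gh _ _)).
Qed.

Lemma sqmodE (c : R[i]) : (sqmod c)%:C = c^* * c.
Proof. by rewrite mulrC -sqr_normc add_Re2_Im2. Qed.

(** The measurement projector for outcome [b]; it turns output probabilities into squared norms. *)
Definition proj N m b (v : 'cV[R[i]]_(dim N m)) : 'cV[R[i]]_(dim N m) :=
  \col_s (if rightmost (enum_val s) == b then v s 0 else 0).

Lemma proj_fun_mx N m m' b (g : basis N m -> basis N m') v :
    (forall s, rightmost (g s) = rightmost s) ->
  proj b (fun_mx g *m v) = fun_mx g *m proj b v.
Proof.
move=> g_rm; apply/colP => s; rewrite !mxE -[RHS]/(\sum_t _).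
have [e|ne] := eqVneq (rightmost (enum_val s)) b; last first.
  rewrite big1 // => t _; rewrite !mxE.
  case: eqP => [st|_]; last by rewrite mul0r.
  by rewrite -[rightmost _]g_rm -st (negbTE ne) mulr0.
apply: eq_bigr => t _; rewrite !mxE.
case: eqP => [st|_]; last by rewrite !mul0r.
by rewrite -[rightmost _]g_rm -st e eqxx.
Qed.

Lemma out_prob_dot N (A : qalg R N) x b :
  (out_prob A x b)%:C =
  dot (proj b (final_state A x)) (proj b (final_state A x)).
Proof.
rewrite dotE rmorph_sum /= big_mkcond; apply: eq_bigr => s _; rewrite !mxE.
by case: ifP => _; rewrite ?mulr0 ?sqmodE.
Qed.

Lemma oracle_map_inj N m x : injective (@oracle_map N m x).
Proof. by move=> [[i b] z] [[j c] w] [/= -> + ->] => /addIb ->. Qed.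

Lemma dot_oracle N m (x y : N.-tuple bool) (u v : 'cV[R[i]]_(dim N m)) :
  dot (oracle R m x *m u) (oracle R m x *m v) = dot u v.
Proof. exact/dot_fun_mx/oracle_map_inj. Qed.

Definition state N (A : qalg R N) (t : nat) (x : N.-tuple bool) :
    'cV[R[i]]_(dim N (workspace A)) :=
  foldl (fun v U => U *m (oracle R _ x *m v)) (unitary0 A *m ket0 R _ _)
        (take t (unitaries A)).

Lemma stateS N (A : qalg R N) t x : (t < queries A)%N ->
  state A t.+1 x = nth 0 (unitaries A) t *m (oracle R _ x *m state A t x).
Proof. by move=> tA; rewrite /state (take_nth 0) // foldl_rcons. Qed.

Lemma state_queries N (A : qalg R N) x : state A (queries A) x = final_state A x.
Proof. by rewrite /state take_size. Qed.

(** The unitary after the query cancels. This supplies the Gram identity that [gram_unitary]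
    requires at each query of a mixture. *)
Lemma dot_stateS N (A : qalg R N) t x y : (t < queries A)%N ->
  dot (state A t.+1 x) (state A t.+1 y) =
  dot (oracle R _ x *m state A t x) (oracle R _ y *m state A t y).
Proof.
move=> tA; rewrite !stateS // dot_unitary //.
exact: (allP (unitariesP A) _ (mem_nth 0 tA)).
Qed.

Lemma dot_ket0 N m : (0 < N)%N -> dot (ket0 R N m) (ket0 R N m) = 1.
Proof.
move=> N0; pose s0 : basis N m := (Ordinal N0, false, [tuple of nseq m false]).
rewrite dotE (bigD1 (enum_rank s0)) //= big1 => [|s ns].
  by rewrite !mxE enum_rankK /is_zero /= eqxx conjC1 mulr1 addr0.
rewrite !mxE /is_zero; case: eqP => [e0|]; last by rewrite mulr0.
case: (enum_val s) (enum_valK s) e0 => [[i b] z] /= es i0.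
case: b es => es; first by rewrite mulr0.
case: eqP => [ez|]; last by rewrite mulr0.
case/eqP: ns; rewrite -es; congr enum_rank; rewrite ez; congr (_, _, _).
exact: val_inj.
Qed.

Lemma dot_state0 N (A : qalg R N) x y : (0 < N)%N ->
  dot (state A 0 x) (state A 0 y) = 1.
Proof. by move=> N0; rewrite /state take0 dot_unitary ?unitary0P ?dot_ket0. Qed.

Lemma dot_state N (A : qalg R N) t x : (0 < N)%N -> (t <= queries A)%N ->
  dot (state A t x) (state A t x) = 1.
Proof.
move=> N0; elim: t => [|t IHt] tA; first exact: dot_state0.
by rewrite dot_stateS // dot_oracle // IHt // ltnW.
Qed.

Lemma out_prob_sum1 N (A : qalg R N) x : (0 < N)%N ->
  out_prob A x true + out_prob A x false = 1.
Proof.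
move=> N0; apply: complexI; rewrite rmorph1 -(dot_state x N0 (leqnn (queries A))).
rewrite state_queries dotE rmorphD !rmorph_sum /= big_mkcond /=.
rewrite [X in _ + X = _]big_mkcond -big_split /=; apply: eq_bigr => s _.
by case: rightmost; rewrite /= ?addr0 ?add0r sqmodE.
Qed.

Lemma out_prob_ge0 N (A : qalg R N) x b : 0 <= out_prob A x b.
Proof. by apply: sumr_ge0 => s _; rewrite addr_ge0 ?sqr_ge0. Qed.

End Runs.

(** * Mixtures of query algorithms *)

Section Mixture.
Variables (R : realType) (N : nat) (N_gt0 : (0 < N)%N).
Variables (J : finType) (A : J -> qalg R N) (p : J -> R).
Hypotheses (p_ge0 : forall j, 0 <= p j) (p_sum1 : \sum_j p j = 1).

Definition cell : finType := {j : J & (workspace (A j)).-tuple bool}.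

Definition cell_of j (s : basis N (workspace (A j))) : cell :=
  Tagged (fun j => (workspace (A j)).-tuple bool) s.2.

Definition onehot (z : cell) : #|cell|.-tuple bool :=
  [tuple k == enum_rank z | k < #|cell|].

Lemma onehot_inj : injective onehot.
Proof.
move=> z w /(congr1 (fun u => tnth u (enum_rank z))).
by rewrite !tnth_mktuple eqxx => /esym/eqP/enum_rank_inj.
Qed.

Definition mix_dim : nat := #|cell|.+1.

(* The workspace holds a one-hot encoding of the pair (j, z), followed by an
   output bit, which is only filled in (c = true) at the end of the run. *)
Definition sector (c : bool) j (s : basis N (workspace (A j))) :
    basis N mix_dim :=
  (s.1, [tuple of rcons (onehot (cell_of s)) (c && rightmost s)]).

Lemma sector_cell c j k s t : @sector c j s = @sector c k t ->
  cell_of s = cell_of t.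
Proof.
move=> /(congr1 (fun u => val u.2)) /rcons_inj[e _].
exact/onehot_inj/val_inj.
Qed.

Lemma sector_inj c j : injective (@sector c j).
Proof.
move=> s t e; have := sector_cell e; move/(congr1 fst): e => /=.
case: s t => [s z] [t w] /= -> /eqP; rewrite eq_Tagged /= => /eqP -> //.
Qed.

Lemma sector_disjoint c j k s t : j != k -> @sector c j s != @sector c k t.
Proof. by move=> /eqP njk; apply/eqP => /sector_cell/(congr1 tag). Qed.

Lemma rightmost_sector j s : rightmost (@sector true j s) = rightmost s.
Proof. by rewrite {1}/rightmost /= last_rcons. Qed.

Definition mix c (u : forall j, 'cV[R[i]]_(dim N (workspace (A j)))) :
    'cV[R[i]]_(dim N mix_dim) :=
  \sum_j (Num.sqrt (p j))%:C *: (fun_mx R (@sector c j) *m u j).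

(** Distinct sectors are orthogonal, so cross terms vanish and Gram matrices average with weights
    [p j], whatever [c] is. *)
Lemma dot_mix c u w :
  dot (mix c u) (mix c w) = \sum_j (p j)%:C * dot (u j) (w j).
Proof.
rewrite dot_suml; apply: eq_bigr => j _; rewrite dot_sumr (bigD1 j) //=.
rewrite big1 => [|k nkj]; last first.
  by rewrite dotZ dot_fun_mx0 ?mulr0 // => s t; rewrite sector_disjoint // eq_sym.
rewrite addr0 dotZ (conjc_real _ : Num.conj _%:C = _) -rmorphM -expr2 sqr_sqrtr //.
by rewrite dot_fun_mx //; exact: sector_inj.
Qed.

Lemma oracle_mix x u :
  oracle R mix_dim x *m mix false u = mix false (fun j => oracle R _ x *m u j).
Proof.
rewrite mulmx_sumr; apply: eq_bigr => j _; rewrite -scalemxAr; congr (_ *: _).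
by rewrite !mulmxA !fun_mx_comp.
Qed.

Lemma proj_mix b u : proj b (mix true u) = mix true (fun j => proj b (u j)).
Proof.
rewrite /mix; under [RHS]eq_bigr do
  rewrite -(proj_fun_mx _ _ (@rightmost_sector _)).
apply/colP => s; rewrite !mxE !summxE; case: ifP => e.
  by apply: eq_bigr => j _; rewrite !mxE e.
by rewrite big1 // => j _; rewrite !mxE e mulr0.
Qed.

Lemma mixture T : (forall j, queries (A j) = T) ->
  exists B, [/\ queries B = T, (0 < workspace B)%N &
    forall x b, out_prob B x b = \sum_j p j * out_prob (A j) x b].
Proof.
(* The intended state after [t] queries. The flag [t == T] makes the last unitary fill in the output
   bit; for [T = 0] that is already [U0]. *)
move=> AT; pose psi t x := mix (t == T) (fun j => state (A j) t x).
have [U0 U0U U0E] : exists2 U0 : 'M_(dim N mix_dim), U0 \is unitarymx &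
    forall x, U0 *m ket0 R _ _ = psi 0%N x.
  apply: (@gram_unitary _ _ _ (fun=> ket0 R _ _) (psi 0%N)) => x y.
  rewrite dot_mix dot_ket0 // -[LHS](rmorph1 (real_complex R)) -p_sum1 rmorph_sum.
  by apply: eq_bigr => j _; rewrite dot_state0 // mulr1.
have /choice[U UE] t : exists U : 'M_(dim N mix_dim), U \is unitarymx /\
    ((t < T)%N -> forall x, U *m (oracle R _ x *m psi t x) = psi t.+1 x).
  have [tT|_] := ltnP t T; last by exists 1%:M; split=> //; exact: unitarymx1.
  have [|V VU VE] := @gram_unitary _ _ _
    (fun x => oracle R mix_dim x *m psi t x) (psi t.+1).
    (* Before the query [c] is false, as [oracle_mix] requires; afterwards either value of [c] gives
       the same Gram matrix. *)
    move=> x y; rewrite /psi ltn_eqF // !oracle_mix !dot_mix.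
    by apply: eq_bigr => j _; rewrite dot_stateS ?AT.
  by exists V.
have UsU : all (fun V => V \is unitarymx) (mkseq U T).
  by apply/allP => _ /mapP[t _ ->]; case: (UE t).
pose B := QAlg U0U UsU; exists B.
have BT : queries B = T by rewrite /queries size_mkseq.
split=> // x b; apply: complexI; rewrite out_prob_dot.
have -> : final_state B x = psi T x.
  rewrite /final_state /= (U0E x).
  suff H k : (k <= T)%N -> foldl (fun v V => V *m (oracle R _ x *m v))
    (psi 0%N x) (mkseq U k) = psi k x by exact: H.
  elim: k => // k IHk kT; rewrite mkseqS foldl_rcons IHk ?(ltnW kT) //.
  by case: (UE k) => _ ->.
rewrite /psi eqxx proj_mix dot_mix rmorph_sum; apply: eq_bigr => j _ /=.
by rewrite rmorphM /= out_prob_dot -state_queries AT.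
Qed.

End Mixture.

(* If there is no workspace, further queries would flip the output bit; a
   one-element mixture first moves the output into the workspace. *)
Lemma pad_queries (R : realType) N (A : qalg R N) T : (0 < N)%N ->
    (queries A <= T)%N ->
  exists2 B, queries B = T & forall x b, out_prob B x b = out_prob A x b.
Proof.
move=> N0 AT.
have [||//|B [BA B0 BE]] :=
  @mixture R N N0 unit (fun=> A) (fun=> 1) _ _ (queries A).
- by move=> _; exact: ler01.
- by rewrite (bigD1 tt) //= big1 ?addr0 // => -[].
have idU : all (fun V => V \is unitarymx)
    (unitaries B ++ nseq (T - queries A) (1%:M)).
  by rewrite all_cat unitariesP all_nseq unitarymx1 orbT.
exists (QAlg (unitary0P B) idU) => [|x b].
  by rewrite /queries size_cat size_nseq -/(queries B) BA subnKC.
transitivity (out_prob B x b); last first.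
  by rewrite BE (bigD1 tt) //= big1 ?addr0 ?mul1r // => -[].
apply: complexI; rewrite !out_prob_dot /final_state /= foldl_cat.
rewrite -/(final_state B x); elim: (T - _)%N (final_state B x) => // k IHk v /=.
rewrite IHk mul1mx proj_fun_mx => [|s]; last first.
  by rewrite /rightmost /=; case: s.2 => -[|z0 z] //= /eqP zB; rewrite -zB in B0.
exact: dot_oracle.
Qed.

(** * From weakly exact algorithms to bounded error *)

Lemma exact_out_prob (R : realType) N (A : qalg R N) x (b : bool) : (0 < N)%N ->
  prob_one A x = b%:R -> out_prob A x b = 1.
Proof.
move=> N0; rewrite /prob_one => Ax; case: b Ax => //= Ax.
by have := out_prob_sum1 A x N0; rewrite Ax add0r.
Qed.

Lemma two_sided_of_weakly_exact (R : realType) N (D : {set N.-tuple bool})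
    (f : {x | x \in D} -> bool) T : (0 < N)%N -> D != set0 ->
    (forall mu : distr R D, exists A, queries A = T /\ weakly_exact mu f A) ->
  exists B : qalg R N, queries B = T /\ two_sided f B.
Proof.
move=> N0 D0 exA; have [x0 x0D] := set0Pn _ D0.
(* There are infinitely many algorithms but only finitely many such sets, so the sets index the rows
   of the game and [choice] picks one algorithm for each. *)
pose P := [pred S : {set {x | x \in D}} | `[< exists A : qalg R N,
  queries A = T /\ forall x, x \in S -> out_prob A (val x) (f x) = 1 >]].
have /choice[A AE] (j : 'I_#|P|) : exists A : qalg R N, queries A = T /\
    forall x, x \in enum_val j -> out_prob A (val x) (f x) = 1.
  by have /asboolP := enum_valP j.
have [mu mu0 mu1|p [p0 p1 pM]] := @minimax R _ _ (exist _ x0 x0D)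
    (fun (j : 'I_#|P|) x => (x \in enum_val j)%:R) (2 / 3).
  have [A' [A'T A'E]] := exA (Distr mu0 mu1).
  pose S := [set x | prob_one A' (val x) == (f x)%:R].
  have SP : S \in P.
    apply/asboolP; exists A'; split=> // x; rewrite inE => /eqP.
    exact: exact_out_prob.
  exists (enum_rank_in SP S); rewrite enum_rankK_in //.
  apply: le_trans A'E _; rewrite big_mkcond ler_sum // => x _.
  by rewrite inE; case: ifP => _; rewrite ?mulr1 ?mulr0.
have [j|B [BT _ BE]] := mixture N0 p0 p1 (A := A) (T := T).
  by case: (AE j).
exists B; split=> // x; rewrite /success_prob BE.
apply: le_trans (pM x) _; apply: ler_sum => j _; apply: ler_wpM2l => //.
(* The 0/1 entry bounds the success probability from below: the latter is 1 on the set and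
   nonnegative off it. *)
case: (boolP (x \in _)) => [/(AE j).2 -> //|_]; exact: out_prob_ge0.
Qed.

Theorem theorem1 (R : realType) (N : nat) (hN : (0 < N)%N)
    (D : {set N.-tuple bool}) (hD : D != set0) (f : {x | x \in D} -> bool) :
  (Q2 R hN f <= max_QWE R hN f hD)%N.
Proof.
rewrite /max_QWE; case: ex_maxnP => T _ maxT.
rewrite /Q2; case: ex_minnP => q _; apply.
apply/asboolP/two_sided_of_weakly_exact => // mu.
(* The best algorithm for [mu] may make fewer than [T] queries, whereas the mixture needs a common
   number; hence the padding. *)
have /maxT : QWE_value R hN f (QWE hN f mu) by apply/asboolP; exists mu.
rewrite /QWE; case: ex_minnP => k /asboolP[A [<- AE]] _ AT.
have [B BT BE] := pad_queries hN AT; exists B; split=> //.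
by move: AE; rewrite /weakly_exact; under eq_bigl do rewrite /prob_one -BE.
Qed.
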